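(* Let $p \in (0,1]$. (1) The Quantile Algorithm (described in the context) terminates after a finite number of rotation steps. (2) The set $W$ produced by the algorithm satisfies $$Q^-_{\tilde X, C}(p) = \bigcap_{w \in W} \left[x(w,p) + H^+(w)\right].$$
   Context: $\tilde X = \{x^1, \ldots, x^N\} \subseteq \mathbb{R}^2$ is a finite set of $N \geq 1$ (pairwise distinct) data points. The closed convex cone $C \subseteq \mathbb{R}^2$ is generated by two linearly independent vectors, $C = \{s_1 b^1 + s_2 b^2 \mid s_1, s_2 \geq 0\}$; its dual cone $C^+ = \{w \in \mathbb{R}^2 \mid w^\top z \geq 0 \text{ for all } z \in C\}$ is generated by two linearly independent vectors $v^1, v^2$, and $B^+ = \{(1-s)v^1 + s v^2 \mid s \in [0,1]\}$ is a base of $C^+$. For $w \in \mathbb{R}^2\setminus\{0\}$, $H^+(w) = \{z \in \mathbb{R}^2 \mid w^\top z \geq 0\}$. $\#$ denotes cardinality, and $K := \lceil Np\rceil$. $F_{\tilde X, w}(z) = \frac{1}{N}\#\{x \in \tilde X \mid x \in z - H^+(w)\}$ for $w \in B^+$, $F_{\tilde X, C}(z) = \min_{w \in B^+} F_{\tilde X, w}(z)$, $Q^-_{\tilde X, w}(p) = \{z \in \mathbb{R}^2 \mid F_{\tilde X, w}(z) \geq p\}$ and $Q^-_{\tilde X, C}(p) = \{z \in \mathbb{R}^2 \mid F_{\tilde X, C}(z) \geq p\}$. For $w\in B^+$ there is a data point $x(w,p) \in \tilde X$ with $Q^-_{\tilde X, w}(p) = x(w,p) + H^+(w)$ (the number $w^\top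 x(w,p)$ does not depend on the choice of such a point). Put $X^=(w,p) = \{x \in \tilde X \mid w^\top x = w^\top x(w,p)\}$ and $X^<(w,p) = \{x \in \tilde X \mid w^\top x < w^\top x(w,p)\}$. Rotation step with input $w \in B^+\setminus\{v^2\}$: choose a permutation $\pi_w$ of $\{1,\ldots,N\}$ with $w^\top x^{\pi_w(1)} \leq \ldots \leq w^\top x^{\pi_w(N)}$ such that, in addition, the points of $X^=(w,p)$ (which occupy consecutive positions, including position $K$) are listed in increasing order of $(v^2)^\top x$. For $s \in [0,1]$ set $w(s) = (1-s)w + s v^2$, and let $\bar s$ be the maximal $s \in [0,1]$ subject to $$w(s)^\top x^{\pi_w(k)} \leq w(s)^\top x^{\pi_w(K)} \ (k = 1,\ldots,K-1), \qquad w(s)^\top x^{\pi_w(k)} \geq w(s)^\top x^{\pi_w(K)} \ (k = K+1,\ldots,N).$$ The output is $w(\bar s)$. Quantile Algorithm. Step 1: set $n := 1$, $w^1 := v^1$, $W := \{w^1\}$, $RI := \emptyset$. Step 2: until $w^n = v^2$, repeat: perform the rotation step with input $w^n$, call the output $w^{n+1}$, update $W := W \cup \{w^{n+1}\}$, update $n := n+1$; if then $w^n \neq v^2$ and $\#X^<(w^n,p) + \#X^=(w^n,p) = K$, update $RI := RI \cup \{n\}$. Step 3: update $W := W \setminus \{w^k \mid k \in RI\}$. Step 4: compute the intersection $\bigcap_{w \in W}[x(w,p) + H^+(w)]$ while removing redundant elements from $W$ (elements whose removal does not change the intersection). *)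

(* Defs.v *)
From mathcomp Require Import all_boot all_order all_fingroup all_algebra.
From mathcomp Require Import all_classical reals.

Set Implicit Arguments.
Unset Strict Implicit.
Unset Printing Implicit Defensive.

Import Order.TTheory GRing.Theory Num.Theory.

Local Open Scope classical_set_scope.
Local Open Scope ring_scope.

Section Geometry.
Variable R : realType.
Local Notation V := 'cV[R]_2.

Definition dot (w z : V) : R := (w^T *m z) 0 0.

Definition cone (a b : V) : set V :=
  [set z | exists s1 s2 : R, [/\ 0 <= s1, 0 <= s2 & z = s1 *: a + s2 *: b]].

Definition dual_cone (C : set V) : set V :=
  [set w | forall z, C z -> 0 <= dot w z].

Definition base (v1 v2 : V) : set V :=
  [set w | exists2 s : R, 0 <= s <= 1 & w = (1 - s) *: v1 + s *: v2].

Definition halfplane (w : V) : set V := [set z | 0 <= dot w z].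

Definition translate (y : V) (A : set V) : set V := [set y + h | h in A].

End Geometry.

(* The data set is given as an injective family x of N points, so that counting
   points is the same as counting indices. *)
Section Quantiles.
Variables (R : realType) (N : nat).
Local Notation V := 'cV[R]_2.
Variables (x : 'I_N -> V) (v1 v2 : V) (p : R).

(* A data point y lies in z - H^+(w) iff z - y lies in H^+(w). *)
Definition Fw (w z : V) : R :=
  #|[pred i : 'I_N | z - x i \in halfplane w]|%:R / N%:R.

(* The infimum is a minimum, see FC_attained below. *)
Definition FC (z : V) : R := inf [set Fw w z | w in base v1 v2].

Definition Qw (w : V) : set V := [set z | p <= Fw w z].

Definition QC : set V := [set z | p <= FC z].

Definition K : nat := `|Num.ceil (N%:R * p)|%N.

(* xq w stands for x(w,p); the data point need not be unique, so the choice is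
   a parameter.  Choices exist by quantile_choice_exists below. *)
Definition quantile_choice (xq : V -> V) : Prop :=
  forall w, base v1 v2 w ->
    (exists i, xq w = x i) /\ Qw w = translate (xq w) (halfplane w).

End Quantiles.

Section Algorithm.
Variables (R : realType) (N : nat).
Local Notation V := 'cV[R]_2.
Variables (x : 'I_N -> V) (v1 v2 : V) (p : R) (xq : V -> V).

Definition Xeq (w : V) : pred 'I_N := [pred i | dot w (x i) == dot w (xq w)].
Definition Xlt (w : V) : pred 'I_N := [pred i | dot w (x i) < dot w (xq w)].

Definition rotated (w : V) (s : R) : V := (1 - s) *: w + s *: v2.

(* Positions in the list x (pi 0), x (pi 1), ... are numbered from 0. *)
Definition admissible_order (w : V) (pi : 'S_N) : Prop :=
  (forall j k : 'I_N, (j <= k)%N -> dot w (x (pi j)) <= dot w (x (pi k))) /\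
  (forall j k : 'I_N, (j <= k)%N -> Xeq w (pi j) -> Xeq w (pi k) ->
     dot v2 (x (pi j)) <= dot v2 (x (pi k))).

Definition rotation_range (w : V) (pi : 'S_N) (kK : 'I_N) : set R :=
  [set s | [/\ 0 <= s <= 1,
     forall k : 'I_N, (k < kK)%N ->
       dot (rotated w s) (x (pi k)) <= dot (rotated w s) (x (pi kK)) &
     forall k : 'I_N, (kK < k)%N ->
       dot (rotated w s) (x (pi k)) >= dot (rotated w s) (x (pi kK))]].

(* A relation, because admissible_order may leave several permutations. *)
Definition rotation_step (w w' : V) : Prop :=
  exists (pi : 'S_N) (kK : 'I_N) (s : R),
    [/\ kK.+1 = K N p, admissible_order w pi,
        rotation_range w pi kK s, ubound (rotation_range w pi kK) s &
        w' = rotated w s].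

(* hist lists w^1, ..., w^n; the indices in RI are 1-based. *)
Record state := State { hist : seq V; Wset : set V; RI : set nat }.

Definition iterate (st : state) (k : nat) : V := nth 0 (hist st) k.-1.
Definition counter (st : state) : nat := size (hist st).
Definition current (st : state) : V := iterate st (counter st).

Definition init : state := State [:: v1] [set v1] set0.

Definition loop_step (st st' : state) : Prop :=
  current st <> v2 /\
  exists2 w', rotation_step (current st) w' &
    st' = State (rcons (hist st) w') (Wset st `|` [set w'])
            (if (w' != v2) && (#|Xlt w'| + #|Xeq w'| == K N p)%N
             then RI st `|` [set (counter st).+1] else RI st).

Inductive reachable : state -> Prop :=
| reachable_init : reachable init
| reachable_step st st' : reachable st -> loop_step st st' -> reachable st'.

(* The loop never gets stuck before w^n = v2, and no resolution of the choices
   in the rotation steps lets it run forever. *)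
Definition terminates : Prop :=
  (forall st, reachable st -> current st <> v2 ->
     exists st', loop_step st st') /\
  ~ (exists run : nat -> state,
       run 0%N = init /\ forall n, loop_step (run n) (run n.+1)).

Definition after_step3 (st : state) : set V :=
  Wset st `\` [set iterate st k | k in RI st].

Definition inter (W : set V) : set V :=
  \bigcap_(w in W) translate (xq w) (halfplane w).

Definition redundant (W : set V) (w : V) : Prop :=
  W w /\ inter (W `\ w) = inter W.

(* Redundant elements are removed one at a time, in any order, until none is
   left; redundancy is always relative to the current set. *)
Inductive reduces (W : set V) : set V -> Prop :=
| reduces_done : (forall w, ~ redundant W w) -> reduces W W
| reduces_remove w W' : redundant W w -> reduces (W `\ w) W' -> reduces W W'.

Definition output (W : set V) : Prop :=
  exists st, [/\ reachable st, current st = v2 & reduces (after_step3 st) W].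

End Algorithm.

Section BasicFacts.
Variables (R : realType) (N : nat).
Local Notation V := 'cV[R]_2.
Variables (x : 'I_N -> V) (v1 v2 : V).

Lemma dotB (w y z : V) : dot w (y - z) = dot w y - dot w z.
Proof. by rewrite /dot mulmxBr !mxE. Qed.

Lemma FwE (w z : V) :
  Fw x w z = #|[pred i : 'I_N | dot w (x i) <= dot w z]|%:R / N%:R.
Proof.
rewrite /Fw; congr (_%:R / _); apply: eq_card => i.
by rewrite !inE -subr_ge0 -dotB; apply/idP/idP; rewrite in_setE.
Qed.

Lemma FC_attained (z : V) :
  exists2 w, base v1 v2 w &
    FC x v1 v2 z = Fw x w z /\ forall w', base v1 v2 w' -> Fw x w z <= Fw x w' z.
Proof.
pose P (m : nat) := `[< exists2 w, base v1 v2 w &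
  #|[pred i : 'I_N | dot w (x i) <= dot w z]| = m >].
have exP : exists m, P m.
  exists #|[pred i : 'I_N | dot v1 (x i) <= dot v1 z]|; apply/asboolP.
  exists v1 => //; exists 0; first by rewrite lexx ler01.
  by rewrite subr0 scale1r scale0r addr0.
case: (ex_minnP exP) => m /asboolP[w Bw wm] minm.
have le w' : base v1 v2 w' -> Fw x w z <= Fw x w' z.
  move=> Bw'; rewrite !FwE ler_wpM2r ?invr_ge0 ?ler0n// ler_nat wm minm//.
  by apply/asboolP; exists w'.
exists w => //; split=> //; apply/eqP; rewrite eq_le; apply/andP; split.
  by apply: ge_inf; [exists (Fw x w z) => _ [w' /le + <-]|exists w].
by apply: lb_le_inf; [exists (Fw x w z); exists w|move=> _ [w' /le + <-]].
Qed.

Lemma quantile_choice_exists (p : R) : (0 < N)%N -> 0 < p <= 1 ->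
  exists xq, quantile_choice x v1 v2 p xq.
Proof.
move=> N0 /andP[p0 p1].
have mono w y z : dot w y <= dot w z -> Fw x w y <= Fw x w z.
  move=> yz; rewrite !FwE ler_wpM2r ?invr_ge0 ?ler0n// ler_nat.
  by apply: subset_leq_card; apply/fintype.subsetP => i; rewrite !inE => /le_trans; apply.
have main w : exists y, (exists i, y = x i) /\ Qw x p w = translate y (halfplane w).
  pose j0 : 'I_N := [arg max_(i > Ordinal N0) dot w (x i)]%O.
  have j0F : p <= Fw x w (x j0).
    rewrite FwE (_ : #|_| = N) ?divff ?pnatr_eq0 -?lt0n//.
    rewrite -[RHS]card_ord; apply: eq_card => i; rewrite !inE /j0.
    by case: arg_maxP => // j _ /(_ i isT).
  case: (@Order.TotalTheory.arg_minP _ _ _ j0 (fun i => p <= Fw x w (x i))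
    (fun i => dot w (x i)) j0F) => i Fi mini.
  exists (x i); split; first by exists i.
  apply/seteqP; split=> z /=.
    rewrite /Qw /= => pz; exists (z - x i); last by rewrite addrC subrK.
    rewrite /halfplane /= dotB subr_ge0.
    case: (pickP [pred j : 'I_N | dot w (x j) <= dot w z]) => [j1 /= hj1|none]; last first.
      by move: pz; rewrite FwE eq_card0 // mul0r leNgt p0.
    case: (@Order.TotalTheory.arg_maxP _ _ _ j1
      (fun j => dot w (x j) <= dot w z) (fun j => dot w (x j)) hj1) => j hj maxj.
    apply: le_trans hj; apply: mini; apply: (le_trans pz).
    rewrite !FwE ler_wpM2r ?invr_ge0 ?ler0n// ler_nat.
    by apply: subset_leq_card; apply/fintype.subsetP => k; rewrite !inE => /maxj.
  case=> h hh <-; apply: (le_trans Fi); apply: mono.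
  by rewrite -subr_ge0 -dotB addrAC subrr add0r.
by have [xq hxq] := choice main; exists xq => w _; apply: hxq.
Qed.

End BasicFacts.

(* Main.v *)
Require Import Defs.
From mathcomp Require Import perm.
From mathcomp Require Import all_boot all_order all_algebra.
From mathcomp Require Import all_classical reals.
From mathcomp Require Import ring lra.
Import Order.TTheory GRing.Theory Num.Theory.
Local Open Scope classical_set_scope.
Local Open Scope ring_scope.

Set Implicit Arguments.
Unset Strict Implicit.

(** Identify w in the base of the dual cone with its parameter t, where
    w_t = (1 - t) v1 + t v2.  Each data point becomes the affine function
    t |-> w_t . x_i, and q(t) := w_t . x(w_t, p) is the K-th smallest of these
    N numbers.  A point z lies in the conical quantile exactly when the affine
    function g(t) = w_t . z is at least q on all of [0, 1], and lies in the
    intersection over W exactly when g >= q at the parameters of W.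

    Rotation and termination.  The admissible order puts at position K the
    point x_i whose affine function equals q immediately to the right of t.
    The ordering constraints of a rotation step hold exactly on an interval
    [0, s] with s > 0, because each of them is affine in the parameter and
    holds at 0, with a favourable slope if it holds with equality
    (first_sign_change, rotation_rangeE).  At its end either v2 is reached or
    two affine functions of different slopes cross.  The parameters visited
    thus increase strictly and lie in the finite set of such crossings
    together with 0 and 1, which bounds the number of steps.

    Correctness.  Between consecutive stops q is affine, so g >= q at both
    ends gives g >= q in between.  At a discarded stop the tied points fill
    the positions up to K, so the point followed next has the largest value
    at v2 among them (rank_point_dominates_ties): q bends upwards there.
    Suppose g drops below q on some piece.  That piece is part of an affine
    function which overtakes g and therefore still exceeds g at v2, and an
    upward bend passes this property on to the next piece; so g stays below q
    up to and including the next stop that is kept.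
    This is the induction of sweep_invariant; since the last stop v2 is kept,
    a z in the intersection can never drop below q.  Removing redundant
    elements does not change the intersection. *)

(** * Simultaneous sign conditions on a segment *)

Section AffineFamilies.
Variables (R : realFieldType) (I : finType) (d e : I -> R).

(** Finitely many affine functions that are nonnegative at 0, and do not
    decrease from a zero there, stay nonnegative up to a positive time s, which
    is either 1 or a zero of one of them.  This gives existence, positivity and
    location of the maximal rotation parameter at once. *)
Lemma first_sign_change :
  (forall i, 0 <= d i) -> (forall i, d i = 0 -> 0 <= e i) ->
  exists s, [/\ 0 < s <= 1,
    s = 1 \/ exists2 i, (1 - s) * d i + s * e i = 0 & e i != 0 &
    forall u, 0 <= u <= 1 ->
      (forall i, 0 <= (1 - u) * d i + u * e i) <-> u <= s].
Proof.
move=> d0 de0.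
(* tau o is the last time in [0, 1] at which constraint o holds; None carries
   the bound 1, so that a minimum exists even when I is empty. *)
pose tau (o : option I) :=
  if o is Some i then if e i < 0 then d i / (d i - e i) else 1 else 1.
have tau01 o : 0 < tau o <= 1.
  case: o => [i|]; rewrite /tau ?ltr01 ?lexx//.
  case: ifP => [ei|]; last by rewrite ltr01 lexx.
  have di : 0 < d i.
    by rewrite lt0r d0 andbT; apply/eqP => /de0; rewrite leNgt ei.
  by rewrite ltr_pdivlMr ?ler_pdivrMr; lra.
case: (@arg_minP _ _ _ None predT tau) => // o _ mino.
have [s0 s1] := andP (tau01 o).
exists (tau o); split; first by rewrite s0.
  case: o {mino s0 s1} => [i|]; last by left.
  rewrite /tau; case: ifP => ei; last by left.
  have di := d0 i; right; exists i; last by rewrite lt_eqF.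
  have ? : d i - e i != 0 by rewrite gt_eqF//; lra.
  by field.
move=> u /andP[u0 u1]; split=> [h|us i].
  case: o {mino s0 s1} => [i|]; rewrite /tau //; case: ifP => // ei.
  by have := h i; have := d0 i => di; rewrite ler_pdivlMr; lra.
case: (ltP (e i) 0) => ei; last by rewrite addr_ge0// mulr_ge0// subr_ge0.
have := le_trans us (mino (Some i) isT); rewrite /tau ei.
by have di := d0 i; rewrite ler_pdivlMr; lra.
Qed.

End AffineFamilies.

(** * Directions and half-planes *)

Section Geometry.
Variables (R : realType).
Local Notation V := 'cV[R]_2.
Implicit Types (a w y z : V) (s t u : R).

Lemma dot_rotated a w s z :
  dot (rotated a w s) z = (1 - s) * dot w z + s * dot a z.
Proof. by rewrite /dot /rotated linearD !linearZ mulmxDl -!scalemxAl !mxE. Qed.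

Lemma translate_halfplaneP w y z :
  translate y (halfplane w) z <-> dot w y <= dot w z.
Proof.
split=> [[h]|wyz].
  by rewrite /halfplane /= => hh <-; rewrite -subr_ge0 -dotB addrC addKr.
exists (z - y); last by rewrite addrC subrK.
by rewrite /halfplane /= dotB subr_ge0.
Qed.

Lemma rotated1 a w : rotated a w 1 = a.
Proof. by rewrite /rotated subrr scale0r scale1r add0r. Qed.

Lemma rotated0 a w : rotated a w 0 = w.
Proof. by rewrite /rotated subr0 scale0r scale1r addr0. Qed.

Lemma rotated_rotated a w t s :
  rotated a (rotated a w t) s = rotated a w (t + s * (1 - t)).
Proof.
rewrite /rotated scalerDr !scalerA -addrA -scalerDl.
by congr (_ *: _ + _ *: _); ring.
Qed.

Lemma rotated_inj a w : a != w -> injective (rotated a w).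
Proof.
move=> aw s t /eqP; rewrite -subr_eq0 (_ : _ - _ = (s - t) *: (a - w)).
  by rewrite scaler_eq0 !subr_eq0 (negbTE aw) orbF => /eqP.
by rewrite /rotated; apply/matrixP => i j; rewrite !mxE; ring.
Qed.

End Geometry.

(** * The quantile as an order statistic *)

Section OrderStatistics.
Variables (R : realType) (N : nat).
Local Notation V := 'cV[R]_2.
Variables (x : 'I_N -> V) (v1 v2 : V) (p : R) (xq : V -> V).
Hypotheses (hN : (0 < N)%N) (hp : 0 < p <= 1) (hxq : quantile_choice x v1 v2 p xq).

Lemma K_leP (m : nat) : (K N p <= m)%N = (p <= m%:R / N%:R).
Proof.
case/andP: hp => p0 _.
rewrite ler_pdivlMr ?ltr0n// mulrC -[m%:R]/(m%:~R) -ceil_le_int /K -lez_nat.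
by rewrite gez0_abs// ceil_ge0 (lt_le_trans (ltrN10 _))// mulr_ge0 ?ler0n// ltW.
Qed.

Lemma K_bounds : (0 < K N p <= N)%N.
Proof.
case/andP: hp => p0 p1.
by rewrite ltnNge !K_leP mul0r -ltNge p0 divff ?pnatr_eq0 -?lt0n.
Qed.

(** The defining property of x(w,p) in terms of counts: the value w . x(w,p) is
    the smallest threshold with at least K data points below it. *)
Lemma quantile_leP w z : base v1 v2 w ->
  (dot w (xq w) <= dot w z) = (K N p <= #|[pred i | (dot w (x i) <= dot w z)%R]|)%N.
Proof.
move=> /hxq[_ Q]; rewrite K_leP -FwE; apply/idP/idP.
  by move=> /translate_halfplaneP; rewrite -Q.
by move=> h; apply/translate_halfplaneP; rewrite -Q.
Qed.

(** Only the positions of the other points relative to k matter, not the order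
    among themselves; hence this still applies after a rotation has shuffled
    the points on either side of k. *)
Lemma quantile_at_rank w (pi : 'S_N) (k : 'I_N) : base v1 v2 w -> k.+1 = K N p ->
  (forall j : 'I_N, (j < k)%N -> dot w (x (pi j)) <= dot w (x (pi k))) ->
  (forall j : 'I_N, (k < j)%N -> dot w (x (pi k)) <= dot w (x (pi j))) ->
  dot w (xq w) = dot w (x (pi k)).
Proof.
move=> Bw kK lo hi; apply/eqP; rewrite eq_le; apply/andP; split.
  (* The k.+1 points at positions up to k lie below the threshold. *)
  rewrite quantile_leP// -kK -[k.+1](card_ord).
  rewrite -(card_codom (f := fun j : 'I_k.+1 => pi (widen_ord (ltn_ord k) j))).
    apply: subset_leq_card; apply/fintype.subsetP => _ /codomP[j ->]; rewrite inE.
    have := ltn_ord j; rewrite ltnS leq_eqVlt => /orP[/eqP jk|]; last first.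
      exact: (lo (widen_ord (ltn_ord k) j)).
    by rewrite (_ : widen_ord _ _ = k)//; apply: val_inj.
  by move=> j j' /perm_inj/(congr1 val)/=/val_inj.
(* Below a smaller threshold only points at positions before k remain. *)
rewrite leNgt; apply/negP => lt.
suff : (#|[pred i | (dot w (x i) <= dot w (xq w))%R]| <= k)%N.
  by apply/negP; rewrite -ltnNge kK -quantile_leP.
rewrite -[X in (_ <= X)%N]card_ord.
rewrite -(card_codom (f := fun j : 'I_k => pi (widen_ord (ltnW (ltn_ord k)) j))).
  apply: subset_leq_card; apply/fintype.subsetP => i; rewrite inE => ile.
  have ik : (pi^-1%g i < k)%N.
    rewrite ltnNge leq_eqVlt; apply/negP => /orP[/eqP/val_inj e|/hi].
      by move: lt; rewrite e permKV ltNge ile.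
    by rewrite permKV leNgt (le_lt_trans ile).
  apply/codomP; exists (Ordinal ik).
  by rewrite (_ : widen_ord _ _ = pi^-1%g i) ?permKV//; apply: val_inj.
by move=> j j' /perm_inj/(congr1 val)/=/val_inj.
Qed.

Lemma admissible_order_exists w : exists pi : 'S_N, admissible_order x v2 xq w pi.
Proof.
(* Sorting lexicographically breaks all ties by v2, not only those at the
   quantile. *)
pose key i : R *l R := (dot w (x i), dot v2 (x i)).
pose le i j := (key i <= key j)%O.
pose s := sort le (enum 'I_N).
have ss : size s = N by rewrite size_sort size_enum_ord.
have us : uniq s by rewrite sort_uniq enum_uniq.
have os : sorted le s by apply: sort_sorted => i j; exact: le_total.
pose f (k : 'I_N) := nth k s k.
have fE i0 k : f k = nth i0 s k by apply: set_nth_default; rewrite ss.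
have finj : injective f.
  move=> j k; rewrite (fE k) => /eqP; rewrite nth_uniq ?ss//.
  by move=> /eqP; apply: val_inj.
have mono (j k : 'I_N) : (j <= k)%N -> le (f j) (f k).
  move=> jk; rewrite (fE k); apply: sorted_leq_nth; rewrite ?inE ?ss//.
  - by move=> ? ? ?; exact: le_trans.
  - by move=> ?; exact: lexx.
exists (perm finj); split=> j k /mono; rewrite !permE /le lexi_pair => /andP[lejk imp] //.
by rewrite /Xeq /= => /eqP ej /eqP ek; move: imp; rewrite ej ek lexx.
Qed.

(** * One rotation step *)

Section RotationStep.
Variables (w : V) (pi : 'S_N) (k : 'I_N).
Hypotheses (Bw : base v1 v2 w) (hk : k.+1 = K N p)
  (hpi : admissible_order x v2 xq w pi).

(** The ordering constraints on both sides of k, normalised by a sign so that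
    each of them says that a gap is nonnegative. *)
Let gap (a : V) (j : 'I_N) : R :=
  (-1) ^+ (k < j)%N * (dot a (x (pi k)) - dot a (x (pi j))).

Lemma rotation_rangeP s : rotation_range x v2 w pi k s <->
  0 <= s <= 1 /\ forall j, 0 <= (1 - s) * gap w j + s * gap v2 j.
Proof.
have gapE j : (1 - s) * gap w j + s * gap v2 j = gap (rotated v2 w s) j.
  by rewrite /gap !dot_rotated; ring.
split=> [[s01 lo hi]|[s01 h]]; split=> // j.
- rewrite gapE /gap; case: (ltngtP j k) => [/lo|/hi|/val_inj ->].
  + by rewrite mul1r subr_ge0.
  + by rewrite mulN1r oppr_ge0 subr_le0.
  + by rewrite subrr mulr0.
- by have := h j; rewrite gapE /gap => /[swap] jk; rewrite ltnNge ltnW// mul1r subr_ge0.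
- by have := h j; rewrite gapE /gap => /[swap] jk; rewrite jk mulN1r oppr_ge0 subr_le0.
Qed.

Lemma quantile_at_admissible_rank : dot w (xq w) = dot w (x (pi k)).
Proof. by apply: quantile_at_rank => // j /ltnW; apply: hpi.1. Qed.

(** The second ordering condition of an admissible order makes the gap of a
    point tied with position k nonnegative at v2, so that ties never obstruct
    the rotation and s is positive. *)
Lemma rotation_rangeE : exists s, [/\ 0 < s <= 1,
  s = 1 \/ exists2 j, dot (rotated v2 w s) (x (pi k)) = dot (rotated v2 w s) (x j) &
                      dot v2 (x (pi k)) != dot v2 (x j) &
  forall u, rotation_range x v2 w pi k u <-> 0 <= u <= s].
Proof.
have gap0 j : 0 <= gap w j.
  rewrite /gap; case: (ltnP k j) => kj.
    by rewrite mulN1r oppr_ge0 subr_le0; apply: hpi.1; apply: ltnW.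
  by rewrite mul1r subr_ge0; apply: hpi.1.
have gap1 j : gap w j = 0 -> 0 <= gap v2 j.
  move=> /eqP; rewrite mulf_eq0 signr_eq0 /= subr_eq0 => /eqP e.
  have Xk : Xeq x xq w (pi k) by rewrite /Xeq /= quantile_at_admissible_rank.
  have Xj : Xeq x xq w (pi j) by rewrite /Xeq /= quantile_at_admissible_rank e.
  rewrite /gap; case: (ltnP k j) => kj.
    by rewrite mulN1r oppr_ge0 subr_le0; apply: hpi.2 => //; apply: ltnW.
  by rewrite mul1r subr_ge0; apply: hpi.2.
have [s [s01 s1 hs]] := first_sign_change gap0 gap1.
exists s; split=> //.
  case: s1 => [->|[j gj ej]]; [by left|right; exists (pi j)].
    apply/eqP; move: gj; rewrite !dot_rotated => /eqP.
    rewrite (_ : _ + _ = (-1) ^+ (k < j)%N * ((1 - s) * (dot w (x (pi k)) - dot w (x (pi j)))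
       + s * (dot v2 (x (pi k)) - dot v2 (x (pi j))))); last by rewrite /gap; ring.
    rewrite mulf_eq0 signr_eq0 /= => /eqP h.
    by rewrite -subr_eq0 -h; apply/eqP; ring.
  by move: ej; rewrite mulf_eq0 signr_eq0 /= subr_eq0.
have [s0 s1'] := andP s01.
move=> u; rewrite rotation_rangeP; split=> [[u01 h]|/andP[u0 us]].
  by have [u0 _] := andP u01; rewrite u0; apply/hs.
have u01 : 0 <= u <= 1 by rewrite u0 (le_trans us).
by split=> //; apply/hs.
Qed.

Lemma quantile_on_rotation_range s : rotation_range x v2 w pi k s ->
  base v1 v2 (rotated v2 w s) ->
  dot (rotated v2 w s) (xq (rotated v2 w s)) = dot (rotated v2 w s) (x (pi k)).
Proof. by case=> _ lo hi B; apply: quantile_at_rank. Qed.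

(** If the points up to the quantile value number exactly K, then all ties sit
    at positions up to K, and the admissible order puts the one with the
    largest value at v2 last.  This is the convexity of the quantile function
    at a discarded direction. *)
Lemma rank_point_dominates_ties : (#|Xlt x xq w| + #|Xeq x xq w| = K N p)%N ->
  forall i, dot w (x i) = dot w (xq w) -> dot v2 (x i) <= dot v2 (x (pi k)).
Proof.
move=> card i wi.
have Xi : Xeq x xq w (pi (pi^-1%g i)) by rewrite permKV /Xeq /= wi.
have Xk : Xeq x xq w (pi k) by rewrite /Xeq /= quantile_at_admissible_rank.
(* A tie beyond position k would leave at least K.+1 points up to the
   quantile value. *)
suff ik : (pi^-1%g i <= k)%N by rewrite -[in leLHS](permKV pi i); apply: hpi.2.
rewrite leqNgt; apply/negP => ki.
suff : (K N p < #|Xlt x xq w| + #|Xeq x xq w|)%N by rewrite card ltnn.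
have -> : (#|Xlt x xq w| + #|Xeq x xq w|)%N = #|[pred j | (dot w (x j) <= dot w (xq w))%R]|.
  rewrite -cardUI [X in (_ + X)%N]eq_card0 ?addn0.
    by apply: eq_card => j; rewrite !inE /= le_eqVlt orbC.
  by move=> j; rewrite !inE /=; apply/negP => /andP[/[swap] /eqP ->]; rewrite ltxx.
rewrite -hk -[k.+2]card_ord.
have kN (j : 'I_k.+2) : (j < N)%N.
  by apply: leq_trans (ltn_ord j) _; apply: leq_trans (ltn_ord (pi^-1%g i)).
rewrite -(card_codom (f := fun j : 'I_k.+2 => pi (Ordinal (kN j)))).
  apply: subset_leq_card; apply/fintype.subsetP => _ /codomP[j ->]; rewrite inE -wi.
  rewrite -[in leRHS](permKV pi i); apply: hpi.1 => /=.
  by apply: leq_trans ki; rewrite -ltnS.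
by move=> j j' /perm_inj/(congr1 val)/=/val_inj.
Qed.

End RotationStep.

Lemma base_rotated w s : base v1 v2 w -> 0 <= s <= 1 -> base v1 v2 (rotated v2 w s).
Proof.
move=> [t /andP[t0 t1] ->] /andP[s0 s1].
exists (t + s * (1 - t)); last exact: rotated_rotated.
by apply/andP; split; nra.
Qed.

Lemma rotation_step_exists w : base v1 v2 w -> exists w', rotation_step x v2 p xq w w'.
Proof.
move=> Bw; have [pi hpi] := admissible_order_exists w.
have /andP[K0 KN] := K_bounds.
have kN : ((K N p).-1 < N)%N by rewrite prednK.
have hk : (Ordinal kN).+1 = K N p by rewrite /= prednK.
have [s [/andP[s0 s1] _ hs]] := rotation_rangeE Bw hk hpi.
exists (rotated v2 w s); exists pi, (Ordinal kN), s; split=> //.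
  by apply/hs; rewrite ltW/=.
by move=> u /hs/andP[].
Qed.

(** The consequences of a rotation step that do not mention the permutation:
    whatever admissible order was chosen, some data point carries the quantile
    over the whole swept segment. *)
Lemma rotation_stepP w w' : base v1 v2 w -> rotation_step x v2 p xq w w' ->
  exists i s, [/\ 0 < s <= 1, w' = rotated v2 w s,
    w' = v2 \/ exists2 j, dot w' (x i) = dot w' (x j) & dot v2 (x i) != dot v2 (x j),
    forall u, 0 <= u <= s ->
      dot (rotated v2 w u) (xq (rotated v2 w u)) = dot (rotated v2 w u) (x i) &
    (#|Xlt x xq w| + #|Xeq x xq w| = K N p)%N ->
      forall j, dot w (x j) = dot w (xq w) -> dot v2 (x j) <= dot v2 (x i)].
Proof.
move=> Bw [pi [k [s [hk hpi rs ubs ->]]]].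
have [s' [/andP[s0 s1] cross hs]] := rotation_rangeE Bw hk hpi.
have es : s = s'.
  apply/eqP; rewrite eq_le; have /hs/andP[_ ->] := rs.
  by apply: ubs; apply/hs; rewrite lexx ltW.
rewrite es; exists (pi k), s'; split=> //; first by rewrite s0.
- by case: cross => [->|]; [left; rewrite rotated1|right].
- move=> u us; have ru : rotation_range x v2 w pi k u by apply/hs.
  by apply: quantile_on_rotation_range => //; apply: base_rotated => //; case: ru.
- exact: rank_point_dominates_ties.
Qed.

(** * Runs of the algorithm *)

Section Run.
Hypothesis v12 : v2 != v1.

(** For points with different slopes, the parameter at which their affine
    functions agree. *)
Definition crossing (i j : 'I_N) : R :=
  dot v1 (x i - x j) / (dot v1 (x i - x j) - dot v2 (x i - x j)).

Definition stops : seq R :=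
  [:: 0, 1 & [seq crossing i j | i <- enum 'I_N, j <- enum 'I_N]].

Lemma crossingE (i j : 'I_N) t :
  dot (rotated v2 v1 t) (x i) = dot (rotated v2 v1 t) (x j) ->
  dot v2 (x i) != dot v2 (x j) -> t = crossing i j.
Proof.
rewrite -subr_eq0 -dotB /crossing => /eqP; rewrite -subr_eq0 -!dotB.
rewrite dot_rotated; set a := dot v1 _; set b := dot v2 _ => /eqP e b0.
have ab : a - b != 0.
  by apply: contra b0 => /eqP ab; apply/eqP; move/eqP: e; nra.
by apply: (mulIf ab); rewrite divfK//; move/eqP: e; lra.
Qed.

Local Notation reachable := (reachable x v1 v2 p xq).
Local Notation ray := (rotated v2 v1).

Lemma currentE (st : state R) : current st = last 0 (hist st).
Proof. by rewrite /current /iterate /counter nth_last. Qed.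

(** The visited directions correspond to strictly increasing parameters in the
    finite list stops; this yields both termination and the fact that no
    direction is visited twice. *)
Lemma reachable_params st : reachable st -> exists ts t,
  [/\ hist st = [seq ray u | u <- rcons ts t], sorted <%R (rcons ts t),
      all (fun u => 0 <= u <= 1) (rcons ts t) & {subset rcons ts t <= stops}].
Proof.
elim=> {st} [|st st' _ [ts [t [hst srt rng sub]]] [cur [w' step ->]]].
  exists [::], 0; split=> //=; first by rewrite rotated0.
    by rewrite lexx ler01.
  by move=> u; rewrite !inE => /eqP ->; rewrite eqxx.
have cst : current st = ray t.
  by rewrite currentE hst map_rcons last_rcons.
have t01 : 0 <= t <= 1 by move: rng; rewrite all_rcons => /andP[].
have [t0 t1] := andP t01.
have t1' : t < 1.
  by rewrite lt_neqAle t1 andbT; apply/eqP => e; apply: cur; rewrite cst e rotated1.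
have Bw : base v1 v2 (current st) by rewrite cst; exists t.
have [i [s [/andP[s0 s1] w's stop _ _]]] := rotation_stepP Bw step.
exists (rcons ts t), (t + s * (1 - t)).
have w't : w' = ray (t + s * (1 - t)) by rewrite w's cst rotated_rotated.
split; rewrite /=.
- by rewrite hst w't -map_rcons.
- have tt' : t < t + s * (1 - t) by nra.
  by case: (ts) srt => [|a l] /=; rewrite ?rcons_path ?last_rcons => srt'; apply/andP.
- by rewrite all_rcons rng andbT; apply/andP; split; nra.
- move=> u; rewrite mem_rcons inE => /orP[/eqP ->|/sub//].
  case: stop => [w'2|[j]].
    have -> : t + s * (1 - t) = 1.
      by apply: (rotated_inj v12); rewrite -w't w'2 rotated1.
    by rewrite !inE eqxx orbT.
  rewrite w't => e /(crossingE e) ->.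
  by rewrite !inE; apply/orP; right; apply/orP; right; apply: allpairs_f; rewrite mem_enum.
Qed.

Lemma reachable_base st : reachable st ->
  forall w, w \in hist st -> base v1 v2 w.
Proof.
move=> /reachable_params[ts [t [-> _ rng _]]] _ /mapP[u ut ->].
by exists u => //; apply: (allP rng).
Qed.

Lemma reachable_current st : reachable st -> exists2 t, 0 <= t <= 1 & current st = ray t.
Proof.
move=> /reachable_params[ts [t [e _ + _]]]; rewrite all_rcons => /andP[t01 _].
by exists t => //; rewrite currentE e map_rcons last_rcons.
Qed.

Lemma reachable_current_mem st : reachable st -> current st \in hist st.
Proof.
move=> /reachable_params[ts [t [e _ _ _]]].
by rewrite currentE e map_rcons last_rcons mem_rcons mem_head.
Qed.

Lemma reachable_uniq st : reachable st -> uniq (hist st).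
Proof.
move=> /reachable_params[ts [t [-> srt _ _]]].
by rewrite map_inj_uniq; [exact: lt_sorted_uniq|exact: rotated_inj].
Qed.

Lemma reachable_size st : reachable st -> (size (hist st) <= size stops)%N.
Proof.
move=> /reachable_params[ts [t [-> srt _ sub]]].
by rewrite size_map uniq_leq_size// (lt_sorted_uniq srt).
Qed.

Lemma algorithm_terminates : terminates x v1 v2 p xq.
Proof.
split=> [st rst cur|[run [run0 runS]]].
  have [t t01 ct] := reachable_current rst.
  have Bst : base v1 v2 (current st) by rewrite ct; exists t.
  have [w' hw'] := rotation_step_exists Bst.
  by eexists; split=> //; exists w'.
have rr n : reachable (run n).
  by elim: n => [|n IH]; [rewrite run0; constructor|econstructor; eauto].
have sz n : size (hist (run n)) = n.+1.
  elim: n => [|n IH]; first by rewrite run0.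
  by case: (runS n) => _ [w' _ ->] /=; rewrite size_rcons IH.
by have := reachable_size (rr (size stops)); rewrite sz ltnn.
Qed.

Lemma reachable_Wset st : reachable st -> Wset st = [set w | w \in hist st].
Proof.
elim=> {st} [|st st' _ IH [_ [w' _ ->]]] /=.
  by apply/seteqP; split=> w /=; rewrite inE => /eqP.
rewrite IH; apply/seteqP; split=> w /=; rewrite mem_rcons inE.
  by case=> ->; rewrite ?eqxx ?orbT.
by case/predU1P=> [->|]; [right|left].
Qed.

Lemma reachable_RI st : reachable st -> forall k, RI st k ->
  [/\ (k.-1 < size (hist st))%N, iterate st k != v2 &
      (#|Xlt x xq (iterate st k)| + #|Xeq x xq (iterate st k)| = K N p)%N].
Proof.
elim=> {st} [|st st' rst IH [_ [w' _ ->]]] k //=.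
set st1 := State _ _ _.
have old : RI st k -> [/\ (k.-1 < size (hist st1))%N, iterate st1 k != v2 &
      (#|Xlt x xq (iterate st1 k)| + #|Xeq x xq (iterate st1 k)| = K N p)%N].
  move=> /IH[ks]; rewrite /iterate /= size_rcons nth_rcons ks.
  by split=> //; apply: ltnW.
case: ifP => [/andP[w'2 /eqP card]|_]; last exact: old.
case=> [/old//|->]; rewrite /iterate /= size_rcons nth_rcons ltnn eqxx.
by split.
Qed.

(** A newly discarded direction has not been visited before, so discarding it
    does not remove any direction kept so far. *)
Lemma after_step3_mono st st' : reachable st -> loop_step x v2 p xq st st' ->
  after_step3 st `<=` after_step3 st'.
Proof.
move=> rst step; have := reachable_uniq (reachable_step rst step).
case: step => _ [w' _ ->] /=; rewrite rcons_uniq => /andP[w'h _] w [Ww nRI].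
split; first by left.
have wh : w \in hist st by move: Ww; rewrite reachable_Wset.
case=> k; rewrite /iterate /= => kRI kw.
have [kRI'|kn] : RI st k \/ k = (counter st).+1.
- by move: kRI; case: ifP => _; [case|]; auto.
- have [ks _ _] := reachable_RI rst kRI'.
  by apply: nRI; exists k => //; rewrite -kw nth_rcons ks.
- move: kw; rewrite kn nth_rcons ltnn eqxx => w'w.
  by move: w'h; rewrite w'w wh.
Qed.

(** Either z satisfies all constraints swept so far, or it violates the current
    one with a witness x_i on the quantile line that also separates it at v2.
    The second alternative is stable along linear pieces, because both
    inequalities pass to convex combinations with v2, and at discarded stops,
    because the next witness dominates the previous one at v2; at a kept stop
    it contradicts the hypothesis on z. *)
Lemma sweep_invariant st z : reachable st -> inter xq (after_step3 st) z ->
  forall t, 0 <= t <= 1 -> current st = ray t ->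
  (forall u, 0 <= u <= t -> dot (ray u) (xq (ray u)) <= dot (ray u) z) \/
  exists i, [/\ dot (ray t) (x i) = dot (ray t) (xq (ray t)),
    dot (ray t) z < dot (ray t) (x i) & dot v2 z < dot v2 (x i)].
Proof.
elim=> {st} [|st st' rst IH step] zin t t01 ct.
  have t0 : t = 0 by apply: (rotated_inj v12); rewrite -ct rotated0.
  left=> u; rewrite t0 => /andP[u0 u0']; have -> : u = 0 by apply: le_anti; rewrite u0'.
  rewrite rotated0; apply/translate_halfplaneP; apply: zin.
  by split=> //; case.
have zin' : inter xq (after_step3 st) z.
  by move=> w /(after_step3_mono rst step); apply: zin.
have [t1 t101 ct1] := reachable_current rst.
have [t10 t11] := andP t101.
have Bw : base v1 v2 (ray t1) by exists t1.
case: (step) => ne [w' step' e]; rewrite ct1 in step' ne.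
have w't : w' = ray t by rewrite -ct e currentE /= last_rcons.
have [i [s [/andP[s0 s1] w's _ seg rank]]] := rotation_stepP Bw step'.
have t1lt : t1 < 1.
  by rewrite lt_neqAle t11 andbT; apply/eqP => e1; apply: ne; rewrite e1 rotated1.
have ts : t = t1 + s * (1 - t1).
  by apply: (rotated_inj v12); rewrite -w't w's rotated_rotated.
have eqt : dot (ray t) (x i) = dot (ray t) (xq (ray t)).
  by rewrite -w't w's seg// ltW//= lexx.
have dotE y : dot (ray t) y = (1 - s) * dot (ray t1) y + s * dot v2 y.
  by rewrite -w't w's dot_rotated.
have eq1 : dot (ray t1) (x i) = dot (ray t1) (xq (ray t1)).
  by have := seg 0; rewrite rotated0 lexx ltW// => <-.
case: (IH zin' t1 t101 ct1) => [below|[j [jq jz j2]]].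
  have := below t1; rewrite t10 lexx -eq1 => /(_ isT) le1.
  (* On the segment from t1 to t the quantile function is that of x i.  If z is
     still above it at t, both ends are fine and so is everything between;
     otherwise x i has overtaken z and hence stays above z up to v2. *)
  case: (leP (dot (ray t) (x i)) (dot (ray t) z)) => [let_|gtt]; [left|right].
    move=> u /andP[u0 ut]; case: (leP u t1) => ut1; first by apply: below; rewrite u0.
    (* r is the parameter of u relative to the segment from ray t1 to v2. *)
    pose r := (u - t1) / (1 - t1).
    have d0 : 0 < 1 - t1 by rewrite subr_gt0.
    have ru : ray u = rotated v2 (ray t1) r.
      by rewrite rotated_rotated divfK ?gt_eqF// addrC subrK.
    have r0 : 0 < r by rewrite divr_gt0// subr_gt0.
    have rs : r <= s by rewrite ler_pdivrMr//; lra.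
    have r0s : 0 <= r <= s by rewrite ltW.
    rewrite ru (seg _ r0s) !(dot_rotated v2 (ray t1) r) -(ler_pM2l s0).
    by move: let_; rewrite !dotE; nra.
  exists i; split=> //; move: gtt; rewrite !dotE; nra.
(* z already violates the constraint at t1, so t1 was discarded. *)
have nin : ~ after_step3 st (ray t1).
  by move/zin'/translate_halfplaneP; rewrite -jq leNgt jz.
have Wt1 : Wset st (ray t1).
  by rewrite (reachable_Wset rst) /= -ct1; apply: reachable_current_mem.
have [k kRI kt1] : [set iterate st k | k in RI st] (ray t1).
  by apply: contrapT => h; apply: nin; split.
have [_ _] := reachable_RI rst kRI; rewrite kt1 => /rank/(_ j jq) ji.
right; exists i; split=> //; last exact: lt_le_trans ji.
by rewrite !dotE eq1 -jq; nra.
Qed.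

End Run.

(** * Correctness *)

Lemma reduces_inter W W' : reduces xq W W' -> inter xq W' = inter xq W.
Proof. by elim=> {W W'} // W w W' [_ e] _ ->. Qed.

Lemma conical_quantileP z :
  QC x v1 v2 p z <-> forall w, base v1 v2 w -> dot w (xq w) <= dot w z.
Proof.
have QwP w : base v1 v2 w -> Qw x p w z <-> dot w (xq w) <= dot w z.
  by move=> Bw; rewrite -translate_halfplaneP; have [_ ->] := hxq Bw.
have [w Bw [FCw min]] := FC_attained x v1 v2 z.
rewrite /QC /= FCw; split=> [h w' Bw'|h].
  by apply/QwP => //; apply: le_trans (min _ Bw').
by apply: (QwP _ Bw).2; apply: h.
Qed.

End OrderStatistics.

Theorem corollary4p3 (R : realType) (N : nat) (x : 'I_N -> 'cV[R]_2)
    (b1 b2 v1 v2 : 'cV[R]_2) (p : R) (xq : 'cV[R]_2 -> 'cV[R]_2)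
    (hN : (0 < N)%N) (hx : injective x)
    (hb : free [:: b1; b2]) (hv : free [:: v1; v2])
    (hdual : dual_cone (cone b1 b2) = cone v1 v2)
    (hp : 0 < p <= 1) (hxq : quantile_choice x v1 v2 p xq) :
  terminates x v1 v2 p xq /\
  (forall W : set 'cV[R]_2, output x v1 v2 p xq W ->
     QC x v1 v2 p = \bigcap_(w in W) translate (xq w) (halfplane w)).
Proof.
have v12 : v2 != v1.
  by have := free_uniq hv; rewrite /= inE andbT eq_sym.
split=> [|W [st [rst cst /reduces_inter red]]]; first exact: algorithm_terminates.
rewrite -[RHS]/(inter xq W) red; apply/seteqP; split=> z.
  move/(conical_quantileP hxq) => zQ w [Ww _]; apply/translate_halfplaneP; apply: zQ => //.
  by move: Ww; rewrite (reachable_Wset rst) => /(reachable_base hN hp hxq v12 rst).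
move=> zin; apply/(conical_quantileP hxq) => // w [t t01 ->].
have v2kept : after_step3 st v2.
  split; last by case=> k /(reachable_RI rst)[_ /eqP].
  rewrite (reachable_Wset rst) /= -cst.
  exact: (reachable_current_mem hN hp hxq v12 rst).
have := zin _ v2kept; rewrite translate_halfplaneP => zv2.
have := sweep_invariant hN hp hxq v12 rst zin (t := 1); rewrite rotated1 lexx ler01.
case=> // [below|[i [iq iz _]]]; first exact: (below t t01).
by move: iz; rewrite iq ltNge zv2.
Qed.
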